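(* Let $M,m$ be coprime positive integers, $m_2$ an integer with $0\le m_2\le m-1$, $\heartsuit\in\{\mathrm I,\mathrm{II},\mathrm{III},\mathrm{IV}\}$, and $(k_1,k_2)$ integers in the range attached to $\heartsuit$ (see context). The twisted numerators of the N=4 modules $\ddot H^{\mathrm{tw}}(\Lambda^{(M)[K(m),m_2](\heartsuit)}_{k_1,k_2})$ are as follows. 1) $\big[\overset{N=4}{R}{}^{(+)\mathrm{tw}}\cdot\mathrm{ch}^{(+)\mathrm{tw}}_{\ddot H(\Lambda^{(M)[K(m),m_2](\heartsuit)}_{k_1,k_2})}\big](\tau,z)$ equals (i) for $\heartsuit=\mathrm I$: $(-1)^{m_2+1}\Psi^{[M,m,m_2+1;\frac12]}_{k_1,\,-(k_1+k_2+1);\,0}(\tau,-z,-z,0)$; (ii) for $\heartsuit=\mathrm{II}$: $(-1)^{m_2+1}\Psi^{[M,m,m_2+1;\frac12]}_{k_1,\,-(k_1+k_2-1);\,0}(\tau,z,z,0)$; (iii) for $\heartsuit=\mathrm{III}$: $(-1)^{m_2+1}\Psi^{[M,m,m_2+1;\frac12]}_{k_1+1,\,-(k_1+k_2);\,0}(\tau,z,z,0)$; (iv) for $\heartsuit=\mathrm{IV}$: $(-1)^{m_2+1}\Psi^{[M,m,m_2+1;\frac12]}_{k_1-1,\,-(k_1+k_2);\,0}(\tau,-z,-z,0)$. 2) $\big[\overset{N=4}{R}{}^{(-)\mathrm{tw}}\cdot\mathrm{ch}^{(-)\mathrm{tw}}_{\ddot H(\Lambda^{(M)[K(m),m_2](\heartsuit)}_{k_1,k_2})}\big](\tau,z)$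 equals (i) for $\heartsuit=\mathrm I$: $\Psi^{[M,m,m_2+1;0]}_{k_1,\,-(k_1+k_2+1);\,0}(\tau,-z,-z,0)$; (ii) for $\heartsuit=\mathrm{II}$: $\Psi^{[M,m,m_2+1;0]}_{k_1,\,-(k_1+k_2-1);\,0}(\tau,z,z,0)$; (iii) for $\heartsuit=\mathrm{III}$: $\Psi^{[M,m,m_2+1;0]}_{k_1+1,\,-(k_1+k_2);\,0}(\tau,z,z,0)$; (iv) for $\heartsuit=\mathrm{IV}$: $\Psi^{[M,m,m_2+1;0]}_{k_1-1,\,-(k_1+k_2);\,0}(\tau,-z,-z,0)$.
   Context: Functions ($\mathrm{Im}\,\tau>0$, $q=e^{2\pi i\tau}$; $m\in\frac12\mathbf Z_{>0}$, $s\in\frac12\mathbf Z$): $$\Phi^{[m,s]}(\tau,z_1,z_2,t)=e^{-2\pi imt}\sum_{j\in\mathbf Z}\Big(\frac{e^{2\pi imj(z_1+z_2)+2\pi isz_1}q^{mj^2+sj}}{1-e^{2\pi iz_1}q^j}-\frac{e^{-2\pi imj(z_1+z_2)-2\pi isz_2}q^{mj^2+sj}}{1-e^{-2\pi iz_2}q^j}\Big),$$ $$\Phi^{(A(1|1))[m,s]}(\tau,z_1,z_2,t)=e^{-2\pi imt}\sum_{j\in\mathbf Z}\Big(\frac{e^{2\pi imj(z_1+z_2)+2\pi isz_1}q^{mj^2+sj}}{(1-e^{2\pi iz_1}q^j)^2}-\frac{e^{-2\pi imj(z_1+z_2)-2\pi isz_2}q^{mj^2+sj}}{(1-e^{-2\pi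 iz_2}q^j)^2}\Big),$$ $$\Psi^{[M,m,s;\varepsilon]}_{j,k;\varepsilon'}(\tau,z_1,z_2,t)=q^{\frac mMjk}e^{\frac{2\pi im}M(kz_1+jz_2)}\Phi^{[m,s]}\big(M\tau,z_1+j\tau+\varepsilon,z_2+k\tau-\varepsilon,\tfrac tM\big),\quad \varepsilon,\varepsilon'\in\{0,\tfrac12\},\ j,k\in\varepsilon'+\mathbf Z.$$ Weights: $\widehat A(1,1)$ is the affine Lie superalgebra of $sl(2|2)/\mathbf CI$ with simple roots $\alpha_0,\dots,\alpha_3$ ($\alpha_1,\alpha_3$ odd), $\delta=\sum\alpha_i$, $\theta=\alpha_1+\alpha_2+\alpha_3$. $\Lambda^{(M)[K(m),m_2](\heartsuit)}_{k_1,k_2}$ ($0\le m_2\le m$) is the principal admissible weight of level $-\frac mM$ with integrable part $-m\Lambda_0-\frac{m_2}2(\alpha_1+\alpha_3)$ and simple subset (with $k_3=k_1$) $\Pi^{(\mathrm I)}=\{k_i\delta+\alpha_i\}_{i=0}^3$, $M=\sum k_i+1$; $\Pi^{(\mathrm{II})}=\{k_i\delta-\alpha_i\}_{i=0}^3$, $M=\sum k_i-1$; $\Pi^{(\mathrm{III})}=\{k_0\delta+\alpha_0,k_1\delta+\alpha_1+\alpha_2,k_2\delta-\alpha_2,k_3\delta+\alpha_2+\alpha_3\}$, $M=\sum k_i+1$; $\Pi^{(\mathrm{IV})}=\{k_0\delta-\alpha_0,k_1\delta-\alpha_1-\alpha_2,k_2\delta+\alpha_2,k_3\delta-\alpha_2-\alpha_3\}$,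 $M=\sum k_i-1$. Ranges: I: $k_1,k_2\ge0$, $2k_1+k_2\le M-1$; II: $k_1,k_2\ge1$, $2k_1+k_2\le M$; III: $k_1\ge0,k_2\ge1$, $2k_1+k_2\le M-1$; IV: $k_1\ge1,k_2\ge0$, $2k_1+k_2\le M$. Characters of $\widehat A(1,1)$-modules: for $\lambda=\Lambda^{(M)[K(m),m_2](\heartsuit)}_{k_1,k_2}$ the numerator of $L(\lambda)$ ($\widehat R^{(\pm)}$ being the denominator and super-denominator of $\widehat A(1,1)$) in the coordinates $(\tau,z_1,z_2,t)=2\pi i(-\tau\Lambda_0+\frac{z_2-z_1}2(\alpha_1+\alpha_3)-z_1\alpha_2+t\delta)$ is $$[\widehat R^{(\pm)}\mathrm{ch}^{(\pm)}_{L(\lambda)}](\tau,z_1,z_2,t)=\sigma_\pm\,\Phi^{(A(1|1))[m,m_2+1]}(M\tau,\zeta_1+a_\pm,\zeta_2+a_\pm,T),$$ with $(\sigma_+,a_+)=((-1)^{m_2+1},\frac12)$, $(\sigma_-,a_-)=(1,0)$ and $(\zeta_1,\zeta_2,MT)$ equal to I: $(z_1+k_1\tau,\ z_2-(k_1+k_2)\tau,\ t+(k_1+k_2)z_1-k_1z_2+k_1(k_1+k_2)\tau)$; II: $(-z_1+k_1\tau,\ -z_2-(k_1+k_2)\tau,\ t-(k_1+k_2)z_1+k_1z_2+k_1(k_1+k_2)\tau)$; III: $(-z_2+k_1\tau,\ -z_1-(k_1+k_2)\tau,\ t+k_1z_1-(k_1+k_2)z_2+k_1(k_1+k_2)\tau)$;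 IV: $(z_2+k_1\tau,\ z_1-(k_1+k_2)\tau,\ t-k_1z_1+(k_1+k_2)z_2+k_1(k_1+k_2)\tau)$. The twisted numerators are $[\widehat R^{(\pm)\mathrm{tw}}\mathrm{ch}^{(\pm)\mathrm{tw}}_{L(\lambda)}](\tau,z_1,z_2,t)=[\widehat R^{(\pm)}\mathrm{ch}^{(\pm)}_{L(\lambda)}](\tau,-z_2-\frac\tau2,-z_1-\frac\tau2,t-\frac{z_1+z_2}2-\frac\tau4)$ (twist by $w_0=r_{\alpha_2}t_{\frac12\alpha_2}$). Reduction: $H^{\mathrm{tw}}(\lambda)$ is the Ramond twisted N=4 superconformal module obtained from $L(\lambda)$ by quantum Hamiltonian reduction with $x=\frac12\theta$, $f=e_{-\theta}$, $J_0=-\alpha_2$ and twist $w_0$. With $\overset{N=4}{R}{}^{(\pm)\mathrm{tw}}$ the twisted denominator and super-denominator of the N=4 superconformal algebra, its numerators are $[\overset{N=4}{R}{}^{(\pm)\mathrm{tw}}\mathrm{ch}^{(\pm)\mathrm{tw}}_{H(\lambda)}](\tau,z)=[\widehat R^{(\pm)\mathrm{tw}}\mathrm{ch}^{(\pm)\mathrm{tw}}_{L(\lambda)}](\tau,z+\frac\tau2,z-\frac\tau2,\frac\tau4)$. For $m_2\le m-1$, $\ddot H^{\mathrm{tw}}(\Lambda^{(M)[K(m),m_2](\heartsuit)}_{k_1,k_2}):=H^{\mathrm{tw}}(\Lambda^{(M)[K(m),m_2](\heartsuit)}_{k_1,k_2})\oplus H^{\mathrm{tw}}(\Lambda^{(M)[K(m),m_2+1](\heartsuit)}_{k_1,k_2})$,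 the highest weight vectors of the two summands having opposite parity, so that $\mathrm{ch}^{(\pm)\mathrm{tw}}_{\ddot H(\Lambda^{(M)[K(m),m_2](\heartsuit)}_{k_1,k_2})}=\mathrm{ch}^{(\pm)\mathrm{tw}}_{H(\Lambda^{(M)[K(m),m_2](\heartsuit)}_{k_1,k_2})}\pm\mathrm{ch}^{(\pm)\mathrm{tw}}_{H(\Lambda^{(M)[K(m),m_2+1](\heartsuit)}_{k_1,k_2})}$. *)

(* Defs.v *)
(* Stdlib reals with Coquelicot's complex numbers. *)
From Stdlib Require Import Reals ZArith.
From Coquelicot Require Import Coquelicot.

Local Open Scope C_scope.

(* e2pi x = e^{2 pi i x}; thus q^r = e2pi (r * tau). *)
Definition cexp (x : C) : C :=
  ((exp (Re x) * cos (Im x))%R, (exp (Re x) * sin (Im x))%R).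

Definition e2pi (x : C) : C := cexp (2 * RtoC PI * Ci * x).

(* Sum of a complex series, and of a family indexed by Z (as j >= 0 plus
   j <= -1); meant for absolutely convergent families, such as all those
   below when 0 < Im tau and 0 < m. *)
Definition Cseries (a : nat -> C) : C :=
  (Series (fun n => Re (a n)), Series (fun n => Im (a n))).

Definition CsumZ (f : Z -> C) : C :=
  Cseries (fun n => f (Z.of_nat n))
  + Cseries (fun n => f (- Z.of_nat (S n))%Z).

(* Phi^{[m,s]} and Phi^{(A(1|1))[m,s]}, for m, s half-integers, m > 0. *)
Definition Phi (m s : R) (tau z1 z2 t : C) : C :=
  e2pi (- (m * t)) *
  CsumZ (fun j =>
    let j' := RtoC (IZR j) in
    let qj := e2pi ((m * j' ^ 2 + s * j') * tau) in
    e2pi (m * j' * (z1 + z2) + s * z1) * qj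
      / (1 - e2pi z1 * e2pi (j' * tau))
    - e2pi (- (m * j' * (z1 + z2)) - s * z2) * qj
      / (1 - e2pi (- z2) * e2pi (j' * tau))).

Definition PhiA11 (m s : R) (tau z1 z2 t : C) : C :=
  e2pi (- (m * t)) *
  CsumZ (fun j =>
    let j' := RtoC (IZR j) in
    let qj := e2pi ((m * j' ^ 2 + s * j') * tau) in
    e2pi (m * j' * (z1 + z2) + s * z1) * qj
      / (1 - e2pi z1 * e2pi (j' * tau)) ^ 2
    - e2pi (- (m * j' * (z1 + z2)) - s * z2) * qj
      / (1 - e2pi (- z2) * e2pi (j' * tau)) ^ 2).

(* (tau, z1, z2) is not a pole of Phi or PhiA11 (the poles do not depend on
   m, s, t). *)
Definition Phi_regular (tau z1 z2 : C) : Prop :=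
  forall j : Z,
    1 - e2pi z1 * e2pi (IZR j * tau) <> 0 /\
    1 - e2pi (- z2) * e2pi (IZR j * tau) <> 0.

(* Psi^{[M,m,s;eps]}_{eps'+j0, eps'+k0; eps'}: the subscripts, which lie in
   eps' + Z, are given by their integral parts j0, k0. *)
Definition Psi (M : Z) (m s eps : R) (j0 k0 : Z) (eps' : R)
    (tau z1 z2 t : C) : C :=
  let M' := RtoC (IZR M) in
  let j := RtoC (eps' + IZR j0) in
  let k := RtoC (eps' + IZR k0) in
  e2pi (m / M' * j * k * tau) * e2pi (m / M' * (k * z1 + j * z2))
  * Phi m s (M' * tau) (z1 + j * tau + eps) (z2 + k * tau - eps) (t / M').

(* The four kinds of simple subsets, with k_3 = k_1 and k_0 fixed by M:
   I   : k_i delta + alpha_i,                      M = k_0+k_1+k_2+k_3 + 1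
   II  : k_i delta - alpha_i,                      M = k_0+k_1+k_2+k_3 - 1
   III : k_0 delta + alpha_0, k_1 delta + alpha_1 + alpha_2,
         k_2 delta - alpha_2, k_3 delta + alpha_2 + alpha_3,
                                                   M = k_0+k_1+k_2+k_3 + 1
   IV  : k_0 delta - alpha_0, k_1 delta - alpha_1 - alpha_2,
         k_2 delta + alpha_2, k_3 delta - alpha_2 - alpha_3,
                                                   M = k_0+k_1+k_2+k_3 - 1 *)
Inductive heart := heartI | heartII | heartIII | heartIV.

Definition k_range (h : heart) (M k1 k2 : Z) : Prop :=
  match h with
  | heartI   => 0 <= k1 /\ 0 <= k2 /\ 2 * k1 + k2 <= M - 1
  | heartII  => 1 <= k1 /\ 1 <= k2 /\ 2 * k1 + k2 <= M
  | heartIII => 0 <= k1 /\ 1 <= k2 /\ 2 * k1 + k2 <= M - 1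
  | heartIV  => 1 <= k1 /\ 0 <= k2 /\ 2 * k1 + k2 <= M
  end%Z.

(* Lambda h M m m2 k1 k2 stands for Lambda^{(M)[K(m),m2](h)}_{k1,k2}: level
   -m/M, integrable part -m Lambda_0 - (m2/2)(alpha_1 + alpha_3), simple
   subset of kind h. *)
Record weight := Lambda {
  w_heart : heart;
  w_M : Z; w_m : Z; w_m2 : Z;
  w_k1 : Z; w_k2 : Z }.

Definition admissible (l : weight) : Prop :=
  (0 < w_M l)%Z /\ (0 < w_m l)%Z /\ Z.gcd (w_M l) (w_m l) = 1%Z /\
  (0 <= w_m2 l <= w_m l)%Z /\
  k_range (w_heart l) (w_M l) (w_k1 l) (w_k2 l).

(* Plus: characters and denominators; Minus: their super versions. *)
Inductive ch_sign := Plus | Minus.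

Definition pm (s : ch_sign) : C :=
  match s with Plus => 1 | Minus => - (1) end.

(* The parameters zeta_1, zeta_2 and M T of the character formula. *)
Definition zeta1 (l : weight) (tau z1 z2 : C) : C :=
  let k1 := RtoC (IZR (w_k1 l)) in
  match w_heart l with
  | heartI   => z1 + k1 * tau
  | heartII  => - z1 + k1 * tau
  | heartIII => - z2 + k1 * tau
  | heartIV  => z2 + k1 * tau
  end.

Definition zeta2 (l : weight) (tau z1 z2 : C) : C :=
  let k12 := RtoC (IZR (w_k1 l + w_k2 l)) in
  match w_heart l with
  | heartI   => z2 - k12 * tau
  | heartII  => - z2 - k12 * tau
  | heartIII => - z1 - k12 * tau
  | heartIV  => z1 - k12 * tau
  end.

Definition MT (l : weight) (tau z1 z2 t : C) : C :=
  let k1 := RtoC (IZR (w_k1 l)) in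
  let k12 := RtoC (IZR (w_k1 l + w_k2 l)) in
  match w_heart l with
  | heartI   => t + k12 * z1 - k1 * z2 + k1 * k12 * tau
  | heartII  => t - k12 * z1 + k1 * z2 + k1 * k12 * tau
  | heartIII => t + k1 * z1 - k12 * z2 + k1 * k12 * tau
  | heartIV  => t - k1 * z1 + k12 * z2 + k1 * k12 * tau
  end.

Definition sigma_sign (s : ch_sign) (m2 : Z) : C :=
  match s with Plus => RtoC (powerRZ (-1) (m2 + 1)) | Minus => 1 end.

Definition a_shift (s : ch_sign) : R :=
  match s with Plus => (1 / 2)%R | Minus => 0%R end.

(* The numerator [R^(s) ch^(s)_{L(l)}] of the affine A(1|1)-module L(l), as a
   meromorphic function.  It is not computed as a pointwise product because it
   is evaluated below on a hyperplane where the affine denominator may vanish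
   and the character may be singular. *)
Definition numer_L (s : ch_sign) (l : weight) (tau z1 z2 t : C) : C :=
  let M := RtoC (IZR (w_M l)) in
  sigma_sign s (w_m2 l) *
  PhiA11 (IZR (w_m l)) (IZR (w_m2 l + 1)) (M * tau)
    (zeta1 l tau z1 z2 + a_shift s) (zeta2 l tau z1 z2 + a_shift s)
    (MT l tau z1 z2 t / M).

Definition numer_L_regular (s : ch_sign) (l : weight) (tau z1 z2 t : C) : Prop :=
  Phi_regular (IZR (w_M l) * tau)
    (zeta1 l tau z1 z2 + a_shift s) (zeta2 l tau z1 z2 + a_shift s).

(* Change of variables of the twist by w_0 = r_{alpha_2} t_{alpha_2/2}, and
   specialisation of the quantum Hamiltonian reduction. *)
Definition twist {T : Type} (F : C -> C -> C -> C -> T) (tau z1 z2 t : C) : T :=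
  F tau (- z2 - tau / 2) (- z1 - tau / 2) (t - (z1 + z2) / 2 - tau / 4).

Definition reduction {T : Type} (F : C -> C -> C -> C -> T) (tau z : C) : T :=
  F tau (z + tau / 2) (z - tau / 2) (tau / 4).

(* The numerator of the Ramond twisted module H^tw(l), and its regular points. *)
Definition numer_H (s : ch_sign) (l : weight) : C -> C -> C :=
  reduction (twist (numer_L s l)).

Definition numer_H_regular (s : ch_sign) (l : weight) : C -> C -> Prop :=
  reduction (twist (numer_L_regular s l)).

(* R4 s is the twisted N=4 (super)denominator, chH s l the (super)character of
   H^tw(l); D s is a set of points (tau, z) at which these meromorphic functions
   are finite, so that their product is the pointwise one. *)
Definition N4_numerators (R4 : ch_sign -> C -> C -> C)
    (chH : ch_sign -> weight -> C -> C -> C) (D : ch_sign -> C -> C -> Prop) : Prop :=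
  forall (s : ch_sign) (l : weight) (tau z : C),
    admissible l -> (0 < Im tau)%R -> D s tau z -> numer_H_regular s l tau z ->
    R4 s tau z * chH s l tau z = numer_H s l tau z.

Definition next_weight (l : weight) : weight :=
  Lambda (w_heart l) (w_M l) (w_m l) (w_m2 l + 1) (w_k1 l) (w_k2 l).

(* (Super)character of H^tw(l) (+) H^tw(next_weight l), the highest weight
   vectors of the two summands having opposite parity. *)
Definition ch_ddotH (chH : ch_sign -> weight -> C -> C -> C)
    (s : ch_sign) (l : weight) (tau z : C) : C :=
  chH s l tau z + pm s * chH s (next_weight l) tau z.

(* Main.v *)
(* The parity shift in the direct sum turns the numerator, for both signs, into
   the difference of PhiA11 at s = m2+1 and at s = m2+2.  Termwise, raising s by
   one multiplies by the quantity x whose double pole (1-x)^-2 occurs, so the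
   difference is Phi at s = m2+1; splitting the series needs their absolute
   convergence, which comes from the Gaussian decay of q^(m j^2).  Substituting
   the point (tau, -z, -z-tau, -z), the image of (tau, z) under reduction and
   twist, then matches the definition of Psi, where the shifts +1/2 and -1/2 of
   z2 agree because m and s are integers. *)

Require Import Defs.
From Stdlib Require Import Reals ZArith Lra Lia.
From Coquelicot Require Import Coquelicot.

Local Open Scope C_scope.

(** * The exponential [e2pi]: additivity, modulus, period 1 *)

Lemma cexp_add (x y : C) : cexp (x + y) = cexp x * cexp y.
Proof.
  unfold cexp, Cmult, Re, Im; simpl.
  rewrite exp_plus, cos_plus, sin_plus.
  apply injective_projections; simpl; ring.
Qed.

Lemma e2pi_add (x y : C) : e2pi (x + y) = e2pi x * e2pi y.
Proof.
  unfold e2pi; rewrite <- cexp_add; f_equal; ring.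
Qed.

Lemma e2pi_1 : e2pi 1 = 1.
Proof.
  unfold e2pi, cexp.
  apply injective_projections; simpl.
  all: match goal with |- context [cos ?t] => replace t with (2 * PI)%R by ring
                  | |- context [sin ?t] => replace t with (2 * PI)%R by ring end.
  - match goal with |- context [exp ?t] => replace t with 0%R by ring end.
    rewrite exp_0, cos_2PI; ring.
  - rewrite sin_2PI; ring.
Qed.

Lemma Cmod_e2pi (x : C) : Cmod (e2pi x) = exp (- (2 * PI * Im x)).
Proof.
  unfold e2pi, cexp, Cmod, Re, Im; simpl.
  match goal with |- sqrt (?e * ?c * (?e * ?c * 1) + ?e * ?s * (?e * ?s * 1)) = _ =>
    replace (e * c * (e * c * 1) + e * s * (e * s * 1))%R
      with (e * e * (s * s + c * c))%R by ring end.
  match goal with |- context [sin ?t] => pose proof (sin2_cos2 t) as H end.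
  unfold Rsqr in H; rewrite H, Rmult_1_r, sqrt_square by (left; apply exp_pos).
  f_equal; ring.
Qed.

Lemma e2pi_neq_0 (x : C) : e2pi x <> 0.
Proof.
  intro H; apply (f_equal Cmod) in H.
  rewrite Cmod_e2pi, Cmod_0 in H.
  pose proof (exp_pos (- (2 * PI * Im x))); lra.
Qed.

Lemma e2pi_add_1 (x : C) : e2pi (x + 1) = e2pi x.
Proof. now rewrite e2pi_add, e2pi_1, Cmult_1_r. Qed.

Lemma e2pi_add_IZR (x : C) (n : Z) : e2pi (x + IZR n) = e2pi x.
Proof.
  revert n; apply Z.peano_ind.
  - f_equal; ring.
  - intros n IH; rewrite <- IH, succ_IZR, RtoC_plus, Cplus_assoc.
    apply e2pi_add_1.
  - intros n IH; rewrite <- IH, <- e2pi_add_1; f_equal.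
    rewrite <- Z.sub_1_r, minus_IZR, RtoC_minus; ring.
Qed.

(** * Convergence of the theta series *)

Lemma exp_le (x y : R) : (x <= y -> exp x <= exp y)%R.
Proof.
  intros [H|H].
  - left; now apply exp_increasing.
  - rewrite H; apply Rle_refl.
Qed.

Lemma ex_series_exp_quadratic (a b c : R) : (a < 0)%R ->
  ex_series (fun n => exp (a * INR n ^ 2 + b * INR n + c)).
Proof.
  intro Ha.
  (* [K] is the maximum over real x of a x^2 + (b + 1) x + c, so completing the square bounds the
     general term by e^K e^(-n), a geometric series. *)
  set (K := (c - (b + 1) ^ 2 / (4 * a))%R).
  apply @ex_series_le with (b := fun n => (exp (-1) ^ n * exp K)%R).
  - intro n.
    assert (Hpow : (exp (-1) ^ n = exp (- INR n))%R).
    { induction n as [|n IH].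
      - simpl; rewrite Ropp_0, exp_0; reflexivity.
      - rewrite S_INR; simpl; rewrite IH, <- exp_plus; f_equal; ring. }
    rewrite Hpow, <- exp_plus.
    change (Rabs (exp (a * INR n ^ 2 + b * INR n + c)) <= exp (- INR n + K)).
    rewrite Rabs_pos_eq by (left; apply exp_pos).
    apply exp_le.
    assert (Heq : (- INR n + K - (a * INR n ^ 2 + b * INR n + c)
              = - a * (INR n + (b + 1) / (2 * a)) ^ 2)%R)
      by (unfold K; field; lra).
    assert (0 <= - a * (INR n + (b + 1) / (2 * a)) ^ 2)%R
      by (apply Rmult_le_pos; [lra | apply pow2_ge_0]).
    lra.
  - apply ex_series_scal_r, ex_series_geom.
    rewrite Rabs_pos_eq by (left; apply exp_pos).
    rewrite <- exp_0; apply exp_increasing; lra.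
Qed.

(** Keeps the theta denominators away from 0: once |b n + c| > 1, the exponential is either at most
    1/e or at least e, and e >= 2. *)
Lemma exp_linear_away_from_1 (b c : R) : b <> 0%R ->
  exists N : nat, forall n : nat, (N <= n)%nat ->
    (/ 2 <= Rabs (1 - exp (b * INR n + c)))%R.
Proof.
  intro Hb.
  destruct (INR_archimed (Rabs b) (Rabs c + 1)) as [N HN].
  { now apply Rabs_pos_lt. }
  exists N; intros n Hn; apply le_INR in Hn.
  assert (He : (2 <= exp 1)%R) by (pose proof (exp_ineq1 1); lra).
  assert (Hbn : (Rabs c + 1 < INR n * Rabs b)%R).
  { apply Rlt_le_trans with (1 := HN).
    apply Rmult_le_compat_r; [apply Rabs_pos | exact Hn]. }
  destruct (Rabs_def2 c (Rabs c + 1)) as [Hc1 Hc2]; [lra|].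
  pose proof (Rle_abs c) as Hc3; pose proof (Rle_abs (- c)) as Hc4.
  rewrite Rabs_Ropp in Hc4.
  destruct (Rdichotomy _ _ Hb) as [Hneg|Hpos].
  - rewrite (Rabs_left b) in Hbn by assumption.
    assert (H1 : (exp (b * INR n + c) <= exp (- (1)))%R) by (apply exp_le; lra).
    assert (H2 : (exp (- (1)) <= / 2)%R)
      by (rewrite exp_Ropp; apply Rinv_le_contravar; lra).
    rewrite Rabs_pos_eq; lra.
  - rewrite (Rabs_pos_eq b) in Hbn by lra.
    assert (H1 : (exp 1 <= exp (b * INR n + c))%R) by (apply exp_le; lra).
    rewrite Rabs_left1; lra.
Qed.

Lemma Rabs_one_sub_Cmod_le (y : C) : (Rabs (1 - Cmod y) <= Cmod (1 - y))%R.
Proof.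
  pose proof (Cmod_triangle (1 - y) y) as H1.
  pose proof (Cmod_triangle (- (1 - y)) 1) as H2.
  replace (1 - y + y) with (RtoC 1) in H1 by ring.
  replace (- (1 - y) + 1) with y in H2 by ring.
  rewrite Cmod_opp in H2; rewrite Cmod_1 in H1, H2.
  apply Rabs_le; lra.
Qed.

Definition absolutely_summable (a : nat -> C) : Prop :=
  ex_series (fun n => Cmod (a n)).

(* The common shape of the two summands in [PhiA11]: [(Z, w)] is
   [(z1 + z2, z1)] for the first and [(- (z1 + z2), - z2)] for the second. *)
Definition theta_term (m s : R) (tau Z w : C) (j : R) : C :=
  e2pi (m * j * Z + s * w) * e2pi ((m * RtoC j ^ 2 + s * j) * tau)
    / (1 - e2pi w * e2pi (j * tau)) ^ 2.

(** The numerator has Gaussian decay and the squared denominator is eventually at least 1/4. Only a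
    tail is estimated, so finitely many small or vanishing denominators do no harm. The affine
    argument c n + d serves both halves of a sum over the integers. *)
Lemma theta_term_summable (m s : R) (tau Z w : C) (c d : R) :
  (0 < m)%R -> (0 < Im tau)%R -> c <> 0%R ->
  absolutely_summable (fun n => theta_term m s tau Z w (c * INR n + d)).
Proof.
  intros Hm Htau Hc; pose proof PI_RGT_0 as Hpi.
  assert (Hpt : (0 < 2 * PI * Im tau)%R) by (apply Rmult_lt_0_compat; lra).
  (* The logarithm of the modulus of e^(2 pi i w) q^(c n + d) is linear in n; these are its
     coefficients. *)
  destruct (exp_linear_away_from_1 (- (2 * PI * Im tau) * c)
              (- (2 * PI * (Im w + d * Im tau)))) as [N HN].
  { apply Rmult_integral_contrapositive_currified; lra. }
  (* Likewise, the logarithm of the modulus of the numerator is quadratic in n, with these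
     coefficients. *)
  destruct (ex_series_exp_quadratic (- (2 * PI * Im tau) * m * c ^ 2)
    (- (2 * PI) * (m * c * Im Z + (2 * m * c * d + s * c) * Im tau))
    (- (2 * PI) * (m * d * Im Z + s * Im w + (m * d ^ 2 + s * d) * Im tau)))
    as [l Hl].
  { apply Ropp_lt_cancel; rewrite Ropp_0.
    replace (- (- (2 * PI * Im tau) * m * c ^ 2))%R
      with (2 * PI * Im tau * m * c ^ 2)%R by ring.
    apply Rmult_lt_0_compat; [now apply Rmult_lt_0_compat|].
    now apply pow2_gt_0. }
  (* The factor 4 is the bound for |1 - y|^(-2) once |1 - y| >= 1/2. *)
  apply ex_intro, (ex_series_scal_r 4) in Hl.
  apply (ex_series_incr_n _ N); apply (ex_series_incr_n _ N) in Hl.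
  refine (ex_series_le _ _ _ Hl); intro n.
  specialize (HN (N + n)%nat ltac:(lia)).
  set (x := INR (N + n)) in *.
  change (Rabs (Cmod (theta_term m s tau Z w (c * x + d))) <=
    exp (- (2 * PI * Im tau) * m * c ^ 2 * x ^ 2
      + - (2 * PI) * (m * c * Im Z + (2 * m * c * d + s * c) * Im tau) * x
      + - (2 * PI) * (m * d * Im Z + s * Im w + (m * d ^ 2 + s * d) * Im tau))
    * 4).
  rewrite Rabs_pos_eq by apply Cmod_ge_0.
  unfold theta_term; rewrite <- e2pi_add.
  set (y := e2pi w * e2pi (RtoC (c * x + d) * tau)).
  assert (Hy : (/ 2 <= Cmod (1 - y))%R).
  { apply Rle_trans with (2 := Rabs_one_sub_Cmod_le y).
    unfold y; rewrite <- e2pi_add, Cmod_e2pi.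
    match goal with |- context [exp ?t] => replace t with
      (- (2 * PI * Im tau) * c * x + - (2 * PI * (Im w + d * Im tau)))%R
      by (unfold Re, Im; simpl; ring) end.
    exact HN. }
  assert (Hy0 : 1 - y <> 0) by (intro H; rewrite H, Cmod_0 in Hy; lra).
  rewrite Cmod_div by now apply Cpow_nz.
  rewrite Cmod_e2pi, Cmod_pow.
  match goal with |- (exp ?t / _ <= exp ?u * 4)%R =>
    replace t with u by (rewrite <- RtoC_pow; unfold Re, Im; simpl; ring) end.
  apply Rmult_le_compat_l; [left; apply exp_pos|].
  replace 4%R with (/ (/ 2) ^ 2)%R by field.
  apply Rinv_le_contravar; [lra|].
  apply pow_incr; lra.
Qed.

(** * Termwise subtraction of series and of sums over the integers *)

Lemma absolutely_summable_minus (a b : nat -> C) :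
  absolutely_summable a -> absolutely_summable b ->
  absolutely_summable (fun n => a n - b n).
Proof.
  intros Ha Hb.
  refine (ex_series_le _ _ _ (ex_series_plus _ _ Ha Hb)); intro n.
  change (Rabs (Cmod (a n - b n)) <= Cmod (a n) + Cmod (b n)).
  rewrite Rabs_pos_eq by apply Cmod_ge_0.
  rewrite <- (Cmod_opp (b n)); apply Cmod_triangle.
Qed.

Lemma absolutely_summable_Re_Im (a : nat -> C) : absolutely_summable a ->
  ex_series (fun n => Re (a n)) /\ ex_series (fun n => Im (a n)).
Proof.
  intro Ha; split; refine (ex_series_le _ _ _ Ha); intro n;
    apply Rle_trans with (2 := Rmax_Cmod (a n)).
  - apply Rmax_l.
  - apply Rmax_r.
Qed.

Lemma Cseries_minus (a b : nat -> C) :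
  absolutely_summable a -> absolutely_summable b ->
  Cseries (fun n => a n - b n) = Cseries a - Cseries b.
Proof.
  intros Ha Hb.
  destruct (absolutely_summable_Re_Im a Ha) as [HaR HaI].
  destruct (absolutely_summable_Re_Im b Hb) as [HbR HbI].
  apply injective_projections.
  - exact (Series_minus _ _ HaR HbR).
  - exact (Series_minus _ _ HaI HbI).
Qed.

Lemma CsumZ_ext (f g : Z -> C) : (forall j, f j = g j) -> CsumZ f = CsumZ g.
Proof.
  intro H; unfold CsumZ, Cseries.
  f_equal; apply injective_projections; simpl; apply Series_ext;
    intro n; now rewrite H.
Qed.

Definition absolutely_summableZ (f : Z -> C) : Prop :=
  absolutely_summable (fun n => f (Z.of_nat n)) /\
  absolutely_summable (fun n => f (- Z.of_nat (S n))%Z).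

Lemma absolutely_summableZ_minus (f g : Z -> C) :
  absolutely_summableZ f -> absolutely_summableZ g ->
  absolutely_summableZ (fun j => f j - g j).
Proof.
  intros [Hf Hf'] [Hg Hg']; split.
  - exact (absolutely_summable_minus _ _ Hf Hg).
  - exact (absolutely_summable_minus _ _ Hf' Hg').
Qed.

Lemma CsumZ_minus (f g : Z -> C) :
  absolutely_summableZ f -> absolutely_summableZ g ->
  CsumZ (fun j => f j - g j) = CsumZ f - CsumZ g.
Proof.
  intros [Hf Hf'] [Hg Hg']; unfold CsumZ.
  rewrite (Cseries_minus _ _ Hf Hg), (Cseries_minus _ _ Hf' Hg'); ring.
Qed.

Lemma theta_term_summableZ (m s : R) (tau Z w : C) :
  (0 < m)%R -> (0 < Im tau)%R ->
  absolutely_summableZ (fun j => theta_term m s tau Z w (IZR j)).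
Proof.
  intros Hm Htau; split.
  - apply (ex_series_ext
      (fun n => Cmod (theta_term m s tau Z w (1 * INR n + 0)))).
    + intro n; do 2 f_equal; rewrite <- INR_IZR_INZ; ring.
    + refine (theta_term_summable m s tau Z w 1 0 Hm Htau _); lra.
  (* The negative half starts at j = -1, hence slope -1 and offset -1. *)
  - apply (ex_series_ext
      (fun n => Cmod (theta_term m s tau Z w (-1 * INR n + -1)))).
    + intro n; do 2 f_equal.
      rewrite opp_IZR, <- INR_IZR_INZ, S_INR; ring.
    + refine (theta_term_summable m s tau Z w (-1) (-1) Hm Htau _); lra.
Qed.

(** * From [PhiA11] to [Phi], and from [Phi] to [Psi] *)

Lemma PhiA11_theta_term (m s : R) (tau z1 z2 t : C) :
  PhiA11 m s tau z1 z2 t = e2pi (- (m * t)) *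
    CsumZ (fun j => theta_term m s tau (z1 + z2) z1 (IZR j)
                    - theta_term m s tau (- (z1 + z2)) (- z2) (IZR j)).
Proof.
  unfold PhiA11; f_equal; apply CsumZ_ext; intro j; unfold theta_term.
  replace (- (m * IZR j * (z1 + z2)) - s * z2)
    with (m * IZR j * - (z1 + z2) + s * - z2) by ring.
  reflexivity.
Qed.

(* Raising [s] by one multiplies the numerator by [e^{2 pi i w} q^j], so the
   difference cancels one factor of the double pole. *)
Lemma theta_term_sub_succ (m s : R) (tau Z w : C) (j : R) :
  1 - e2pi w * e2pi (j * tau) <> 0 ->
  theta_term m s tau Z w j - theta_term m (s + 1) tau Z w j
  = e2pi (m * j * Z + s * w) * e2pi ((m * RtoC j ^ 2 + s * j) * tau)
      / (1 - e2pi w * e2pi (j * tau)).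
Proof.
  intro H; unfold theta_term; rewrite RtoC_plus.
  replace (m * j * Z + (s + 1) * w) with (m * j * Z + s * w + w) by ring.
  replace ((m * RtoC j ^ 2 + (s + 1) * j) * tau)
    with ((m * RtoC j ^ 2 + s * j) * tau + j * tau) by ring.
  rewrite (e2pi_add (m * j * Z + s * w)), (e2pi_add ((_ + _) * tau)).
  field; exact H.
Qed.

Lemma PhiA11_sub_succ (m s : R) (tau z1 z2 t : C) :
  (0 < m)%R -> (0 < Im tau)%R -> Phi_regular tau z1 z2 ->
  PhiA11 m s tau z1 z2 t - PhiA11 m (s + 1) tau z1 z2 t
  = Phi m s tau z1 z2 t.
Proof.
  intros Hm Htau Hreg; rewrite !PhiA11_theta_term.
  set (S0 := CsumZ _); set (S1 := CsumZ _).
  unfold Phi; replace (CsumZ _) with (S0 - S1); [ring|].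
  unfold S0, S1; rewrite <- CsumZ_minus
    by (apply absolutely_summableZ_minus; now apply theta_term_summableZ).
  apply CsumZ_ext; intro j; destruct (Hreg j) as [H1 H2].
  (* Regroup by pole family instead of by the value of [s], so that the cancellation applies to each
     pair. *)
  transitivity
    ((theta_term m s tau (z1 + z2) z1 (IZR j)
      - theta_term m (s + 1) tau (z1 + z2) z1 (IZR j))
     - (theta_term m s tau (- (z1 + z2)) (- z2) (IZR j)
        - theta_term m (s + 1) tau (- (z1 + z2)) (- z2) (IZR j))); [ring|].
  rewrite !theta_term_sub_succ by assumption.
  replace (- (m * IZR j * (z1 + z2)) - s * z2)
    with (m * IZR j * - (z1 + z2) + s * - z2) by ring.
  reflexivity.
Qed.

(** As [m] and [s] are integers, every exponent moves by an integer. This will exchange the shifts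
    +1/2 and -1/2 of the second variable. *)
Lemma Phi_add_IZR (m s n : Z) (tau z1 z2 t : C) :
  Phi (IZR m) (IZR s) tau z1 (z2 + IZR n) t = Phi (IZR m) (IZR s) tau z1 z2 t.
Proof.
  unfold Phi; f_equal; apply CsumZ_ext; intro j.
  replace (IZR m * IZR j * (z1 + (z2 + IZR n)) + IZR s * z1)
    with (IZR m * IZR j * (z1 + z2) + IZR s * z1 + IZR (m * j * n))
    by (rewrite !mult_IZR, !RtoC_mult; ring).
  replace (- (IZR m * IZR j * (z1 + (z2 + IZR n))) - IZR s * (z2 + IZR n))
    with (- (IZR m * IZR j * (z1 + z2)) - IZR s * z2 + IZR (- (m * j + s) * n))
    by (rewrite mult_IZR, opp_IZR, plus_IZR, mult_IZR,
          RtoC_mult, RtoC_opp, RtoC_plus, RtoC_mult; ring).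
  replace (- (z2 + IZR n)) with (- z2 + IZR (- n))
    by (rewrite opp_IZR, RtoC_opp; ring).
  now rewrite !e2pi_add_IZR.
Qed.

(** The theta prefactor of [Psi] is absorbed into the last argument of [Phi], which enters only
    through e^(-2 pi i m t). *)
Lemma Psi_Phi (M : Z) (m s eps : R) (j k : Z) (tau w : C) : M <> 0%Z ->
  Psi M m s eps j k 0 tau w w 0
  = Phi m s (IZR M * tau) (w + IZR j * tau + eps) (w + IZR k * tau - eps)
      (- (IZR j * IZR k * tau + (IZR j + IZR k) * w) / IZR M).
Proof.
  intro HM; assert (HM' : RtoC (IZR M) <> 0)
    by (intro H; apply RtoC_inj in H; now apply HM, eq_IZR).
  unfold Psi, Phi; rewrite !Rplus_0_l, !Cmult_assoc, <- !e2pi_add.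
  f_equal; f_equal; field; exact HM'.
Qed.

(** * Numerators of the N=4 modules *)

Lemma numer_H_eq (s : ch_sign) (l : weight) (tau z : C) :
  numer_H s l tau z = numer_L s l tau (- z) (- z - tau) (- z).
Proof.
  unfold numer_H, reduction, twist; f_equal; field.
Qed.

Lemma numer_H_regular_eq (s : ch_sign) (l : weight) (tau z : C) :
  numer_H_regular s l tau z
  = numer_L_regular s l tau (- z) (- z - tau) (- z).
Proof.
  unfold numer_H_regular, reduction, twist; f_equal; field.
Qed.

(** All four kinds are treated at once, since [zeta1], [zeta2] and [MT] do not involve [w_m2]. The
    second variable carries [- a_shift s] to match the -eps of [Psi]. *)
Lemma ddotH_numerator (R4 : ch_sign -> C -> C -> C)
    (chH : ch_sign -> weight -> C -> C -> C) (D : ch_sign -> C -> C -> Prop)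
    (s : ch_sign) (l : weight) (tau z : C) :
  N4_numerators R4 chH D ->
  admissible l -> (w_m2 l < w_m l)%Z -> (0 < Im tau)%R ->
  D s tau z -> numer_H_regular s l tau z ->
  R4 s tau z * ch_ddotH chH s l tau z
  = sigma_sign s (w_m2 l) *
    Phi (IZR (w_m l)) (IZR (w_m2 l + 1)) (IZR (w_M l) * tau)
      (zeta1 l tau (- z) (- z - tau) + a_shift s)
      (zeta2 l tau (- z) (- z - tau) - a_shift s)
      (MT l tau (- z) (- z - tau) (- z) / IZR (w_M l)).
Proof.
  intros HH Hl Hm2 Htau HD Hreg.
  assert (Hl' : admissible (next_weight l)).
  { destruct Hl as (HM & Hm & Hg & Hm2' & Hk).
    repeat split; simpl; trivial; lia. }
  assert (HM : (0 < IZR (w_M l))%R) by apply (IZR_lt 0), Hl.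
  assert (Hm : (0 < IZR (w_m l))%R) by apply (IZR_lt 0), Hl.
  assert (HMtau : (0 < Im (IZR (w_M l) * tau))%R).
  { replace (Im _) with (IZR (w_M l) * Im tau)%R
      by (unfold Im; simpl; ring).
    now apply Rmult_lt_0_compat. }
  unfold ch_ddotH.
  replace (R4 s tau z * (chH s l tau z + pm s * chH s (next_weight l) tau z))
    with (R4 s tau z * chH s l tau z
          + pm s * (R4 s tau z * chH s (next_weight l) tau z)) by ring.
  (* [Hreg] also covers [next_weight l]: the poles do not depend on [w_m2]. *)
  rewrite !HH by assumption.
  rewrite !numer_H_eq; rewrite numer_H_regular_eq in Hreg.
  transitivity (sigma_sign s (w_m2 l) *
    Phi (IZR (w_m l)) (IZR (w_m2 l + 1)) (IZR (w_M l) * tau)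
      (zeta1 l tau (- z) (- z - tau) + a_shift s)
      (zeta2 l tau (- z) (- z - tau) + a_shift s)
      (MT l tau (- z) (- z - tau) (- z) / IZR (w_M l))).
  - rewrite <- PhiA11_sub_succ by assumption.
    rewrite <- plus_IZR.
    unfold numer_L; change (zeta1 (next_weight l)) with (zeta1 l).
    change (zeta2 (next_weight l)) with (zeta2 l).
    change (MT (next_weight l)) with (MT l); simpl w_M; simpl w_m; simpl w_m2.
    (* The minus sign comes from [sigma_sign] changing with the parity of [w_m2] for [Plus], and
       from [pm] for [Minus]. *)
    replace (pm s * (sigma_sign s (w_m2 l + 1) * _)) with
      (- (sigma_sign s (w_m2 l) * PhiA11 (IZR (w_m l)) (IZR (w_m2 l + 1 + 1))
        (IZR (w_M l) * tau)
        (zeta1 l tau (- z) (- z - tau) + a_shift s)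
        (zeta2 l tau (- z) (- z - tau) + a_shift s)
        (MT l tau (- z) (- z - tau) (- z) / IZR (w_M l)))); [ring|].
    destruct s; simpl; [|ring].
    rewrite (powerRZ_add (-1) (w_m2 l + 1)) by lra.
    rewrite powerRZ_1, RtoC_mult; ring.
  - f_equal; destruct s; simpl a_shift.
    (* Adding the period 1 to the shift -1/2 gives +1/2. *)
    + rewrite <- (Phi_add_IZR _ _ 1 _ _ (_ - _)).
      f_equal; rewrite RtoC_div by lra; field.
    + f_equal; ring.
Qed.

Theorem lemma7p2
    (R4 : ch_sign -> C -> C -> C) (chH : ch_sign -> weight -> C -> C -> C)
    (D : ch_sign -> C -> C -> Prop) (HH : N4_numerators R4 chH D)
    (M m m2 k1 k2 : Z) (hM : (0 < M)%Z) (hm : (0 < m)%Z)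
    (hMm : Z.gcd M m = 1%Z) (hm2 : (0 <= m2 <= m - 1)%Z) (tau z : C)
    (htau : (0 < Im tau)%R) :
  let L := fun h => Lambda h M m m2 k1 k2 in
  let ok := fun s h =>
    k_range h M k1 k2 /\ D s tau z /\ numer_H_regular s (L h) tau z in
  let numer := fun s h => R4 s tau z * ch_ddotH chH s (L h) tau z in
  let sg := RtoC (powerRZ (-1) (m2 + 1)) in
  let Psi' := fun eps j k w =>
    Psi M (IZR m) (IZR (m2 + 1)) eps j k 0 tau w w 0 in
  ((ok Plus heartI ->
      numer Plus heartI = sg * Psi' (1 / 2)%R k1 (- (k1 + k2 + 1))%Z (- z)) /\
   (ok Plus heartII ->
      numer Plus heartII = sg * Psi' (1 / 2)%R k1 (- (k1 + k2 - 1))%Z z) /\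
   (ok Plus heartIII ->
      numer Plus heartIII = sg * Psi' (1 / 2)%R (k1 + 1)%Z (- (k1 + k2))%Z z) /\
   (ok Plus heartIV ->
      numer Plus heartIV = sg * Psi' (1 / 2)%R (k1 - 1)%Z (- (k1 + k2))%Z (- z)))
  /\
  ((ok Minus heartI ->
      numer Minus heartI = Psi' 0%R k1 (- (k1 + k2 + 1))%Z (- z)) /\
   (ok Minus heartII ->
      numer Minus heartII = Psi' 0%R k1 (- (k1 + k2 - 1))%Z z) /\
   (ok Minus heartIII ->
      numer Minus heartIII = Psi' 0%R (k1 + 1)%Z (- (k1 + k2))%Z z) /\
   (ok Minus heartIV ->
      numer Minus heartIV = Psi' 0%R (k1 - 1)%Z (- (k1 + k2))%Z (- z))).
Proof.
  intros L ok numer sg Psi'.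
  (* Each of the eight cases reduces to matching [zeta1], [zeta2] and [MT] with the arguments of
     [Phi] in [Psi_Phi]. *)
  assert (Hnumer : forall s h j k w, ok s h ->
    zeta1 (L h) tau (- z) (- z - tau) = w + IZR j * tau ->
    zeta2 (L h) tau (- z) (- z - tau) = w + IZR k * tau ->
    MT (L h) tau (- z) (- z - tau) (- z)
      = - (IZR j * IZR k * tau + (IZR j + IZR k) * w) ->
    numer s h = sigma_sign s m2 * Psi' (a_shift s) j k w).
  { intros s h j k w (Hk & HD & Hreg) H1 H2 H3.
    unfold numer; rewrite (ddotH_numerator R4 chH D) by
      (trivial; unfold admissible; simpl; repeat split; trivial; lia).
    rewrite H1, H2, H3; unfold Psi'; rewrite Psi_Phi by lia.
    reflexivity. }
  repeat split; intro Hok.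
  (* In the [Minus] cases [sigma_sign] is 1, so this factor is inserted to fit [Hnumer]. *)
  5-8: rewrite <- (Cmult_1_l (Psi' _ _ _ _)).
  all: apply (Hnumer _ _ _ _ _ Hok).
  (* What remains are polynomial identities in [k1], [k2], [tau] and [z]. *)
  all: unfold zeta1, zeta2, MT; simpl;
    repeat rewrite ?opp_IZR, ?plus_IZR, ?minus_IZR,
      ?RtoC_opp, ?RtoC_plus, ?RtoC_minus; ring.
Qed.
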